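(* Let $\mathcal{A}$ be a linear map from $\mathbb{R}^{m\times n}$ to $\mathbb{R}^p$ with $p<mn$, and let $y=\mathcal{A}(X)$ with $X\in\mathbb{R}^{m\times n}$, $\operatorname{rank}(X)=r<\min(m,n)$. Let $R_{2r}$ and $R_{3r}$ be restricted isometry constants of $\mathcal{A}$, and let $0<\kappa_1<1$ and $\kappa_2\ge1$ be the numerical constants used in the restarting conditions of the algorithm described in the context. Define $$\varepsilon_\alpha=\frac{R_{2r}}{(1-R_{2r})-\kappa_1(1+R_{2r})},\qquad \varepsilon_\beta=\frac{\kappa_2R_{2r}}{1-R_{2r}}+\frac{\kappa_1\kappa_2}{1-R_{2r}},$$ $$\tau_1=2(R_{2r}+R_{3r})(1+\varepsilon_\alpha)+2\varepsilon_\alpha+\frac{4R_{2r}}{\sigma_{\min}(X)}\|X\|_F+\varepsilon_\beta,\qquad \tau_2=2\varepsilon_\beta(1+\varepsilon_\alpha)(1+R_{2r}),$$ $$\gamma=\tau_1+\tau_2 .$$ (1) Provided $\gamma<1$, the iterates $X_l$ of the restarted Riemannian conjugate gradient descent algorithm (described in the context) with initial point $X_0=\mathcal{H}_r(\mathcal{A}^*(y))$ satisfy $$\|X_l-X\|_F\le\mu^l\|X_0-X\|_F,\qquad\text{where } \mu=\tfrac12\Big(\tau_1+\sqrt{\tau_1^2+4\tau_2}\Big)<1 .$$ (2) Moreover, when $\kappa_1=\kappa_2=0$, $\gamma$ is equal to $\dfrac{4R_{2r}+2R_{3r}}{1-R_{2r}}+\dfrac{4R_{2r}}{\sigma_{\min}(X)}\|X\|_F$.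 (3) On the other hand, $$\lim_{R_{2r},R_{3r}\to0}\gamma=3\kappa_1\kappa_2 ,$$ so whenever $\kappa_1\kappa_2<1/3$, $\gamma$ can be less than $1$ if the restricted isometry constants $R_{2r}$ and $R_{3r}$ of $\mathcal{A}$ are small. (4) In particular, if $\kappa_1=0.1$ and $\kappa_2=1$, a sufficient condition for $\gamma<1$ is $$R_{3r}\le\frac{\sigma_{\min}(X)}{\sigma_{\max}(X)}\cdot\frac{1}{25\sqrt r} .$$
   Context: Matrices are real, $Z^*$ is the transpose, $\langle Y,Z\rangle=\operatorname{trace}(Y^*Z)$ for matrices (and the Euclidean inner product for vectors), $\|\cdot\|_F$ is the Frobenius norm, and $\mathcal{A}^*$ is the adjoint of $\mathcal{A}$. For the rank $r$ matrix $X$, $\sigma_{\max}(X)$ is its largest singular value and $\sigma_{\min}(X)$ its smallest nonzero singular value. Restricted isometry constant: for an integer $0<k\le\min(m,n)$, $R_k$ is the smallest number such that $(1-R_k)\|Z\|_F^2\le\|\mathcal{A}(Z)\|_2^2\le(1+R_k)\|Z\|_F^2$ holds for all $Z\in\mathbb{R}^{m\times n}$ of rank at most $k$. Hard thresholding: $\mathcal{H}_r(Z)$ is obtained from a singular value decomposition of $Z$ by setting all but the $r$ largest singular values to zero (with repeated singular values, any choice may be used); it is a best rank $r$ approximation of $Z$ in the Frobenius norm. Tangent space: if $X_l=U_l\Sigma_lV_l^*$ is the reduced singular value decomposition with $U_l\in\mathbb{R}^{m\times r}$, $\Sigma_l\in\mathbb{R}^{r\times r}$, $V_l\in\mathbb{R}^{n\times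 r}$, then $\mathcal{S}_l=\{U_lR^*+LV_l^*: L\in\mathbb{R}^{m\times r},\,R\in\mathbb{R}^{n\times r}\}$ (the tangent space at $X_l$ of the manifold of rank $r$ matrices), and $\mathcal{P}_{\mathcal{S}_l}$ is the orthogonal projection onto $\mathcal{S}_l$: $\mathcal{P}_{\mathcal{S}_l}(Z)=U_lU_l^*Z+ZV_lV_l^*-U_lU_l^*ZV_lV_l^*$. Restarted Riemannian conjugate gradient descent: given $X_0$, set $\beta_0=0$ and $P_{-1}=0$. For $l=0,1,\dots$: 1. $G_l=\mathcal{A}^*(y-\mathcal{A}(X_l))$. 2. (For $l\ge1$.) $\beta_l$ is set to zero (restart) whenever one of the two conditions $$\frac{|\langle\mathcal{P}_{\mathcal{S}_l}(G_l),\mathcal{P}_{\mathcal{S}_l}(P_{l-1})\rangle|}{\|\mathcal{P}_{\mathcal{S}_l}(G_l)\|_F\,\|\mathcal{P}_{\mathcal{S}_l}(P_{l-1})\|_F}\le\kappa_1\quad\text{and}\quad\|\mathcal{P}_{\mathcal{S}_l}(G_l)\|_F\le\kappa_2\|\mathcal{P}_{\mathcal{S}_l}(P_{l-1})\|_F$$ is violated; otherwise $\beta_l=-\dfrac{\langle\mathcal{A}\mathcal{P}_{\mathcal{S}_l}(G_l),\mathcal{A}\mathcal{P}_{\mathcal{S}_l}(P_{l-1})\rangle}{\|\mathcal{A}\mathcal{P}_{\mathcal{S}_l}(P_{l-1})\|_2^2}$. 3. $P_l=\mathcal{P}_{\mathcal{S}_l}(G_l)+\beta_l\mathcal{P}_{\mathcal{S}_l}(P_{l-1})$.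 4. $\alpha_l=\dfrac{\langle\mathcal{P}_{\mathcal{S}_l}(G_l),\mathcal{P}_{\mathcal{S}_l}(P_l)\rangle}{\|\mathcal{A}\mathcal{P}_{\mathcal{S}_l}(P_l)\|_2^2}$. 5. $W_l=X_l+\alpha_lP_l$. 6. $X_{l+1}=\mathcal{H}_r(W_l)$.
   Formalization: Part (1) additionally assumes (1−R_{2r})−κ_1(1+R_{2r})>0, the denominator of ε_α: if it is slightly negative, γ<1 can hold with μ<0 and the bound fails at l=1. Part (2) assumes R_{2r}≠1 so that the quotient is defined. *)

(* Defs.v *)
From HB Require Import structures.
From mathcomp Require Import all_boot all_order all_algebra.
From mathcomp Require Import all_classical all_reals all_analysis.
Set Implicit Arguments.
Unset Strict Implicit.
Unset Printing Implicit Defensive.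
Import Order.TTheory GRing.Theory Num.Theory.
Import numFieldNormedType.Exports.
Local Open Scope classical_set_scope.
Local Open Scope ring_scope.

Section Matrices.
Variable R : realType.

(* Vectors of R^p are p x 1 matrices: [inner] and [frob] are then the Euclidean
   inner product and norm.  The norm `|_| that the library puts on matrices is
   the sup norm. *)
Definition inner m n (Y Z : 'M[R]_(m, n)) : R := \tr (Y^T *m Z).
Definition frob m n (Z : 'M[R]_(m, n)) : R := Num.sqrt (inner Z Z).

Lemma innerE m n (Y Z : 'M[R]_(m, n)) :
  inner Y Z = \sum_i \sum_j Y i j * Z i j.
Proof.
rewrite /inner /mxtrace exchange_big; apply: eq_bigr => j _ /=.
by rewrite mxE; apply: eq_bigr => i _; rewrite mxE.
Qed.

Definition adjoint m n p (A : {linear 'M[R]_(m, n) -> 'cV[R]_p})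
    (v : 'cV[R]_p) : 'M[R]_(m, n) :=
  \matrix_(i, j) inner (A (delta_mx i j)) v.

Lemma adjointP m n p (A : {linear 'M[R]_(m, n) -> 'cV[R]_p}) Z v :
  inner (A Z) v = inner Z (adjoint A v).
Proof.
rewrite [RHS]innerE [in LHS](matrix_sum_delta Z) /inner linear_sum /=.
rewrite raddf_sum /= mulmx_suml raddf_sum /=; apply: eq_bigr => i _.
rewrite linear_sum raddf_sum /= mulmx_suml raddf_sum /=.
apply: eq_bigr => j _.
by rewrite linearZ /= linearZ /= -scalemxAl linearZ /= mxE.
Qed.

(* Z = U diag(d) V^* with k columns in U and V and nonincreasing nonnegative d.
   For k = min(m, n) this is the full list of singular values; for
   k = rank Z it is the reduced decomposition. *)
Definition is_svd k m n (U : 'M[R]_(m, k)) (d : 'rV[R]_k) (V : 'M[R]_(n, k))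
    (Z : 'M[R]_(m, n)) : Prop :=
  [/\ U^T *m U = 1%:M, V^T *m V = 1%:M, forall i, 0 <= d 0 i,
      forall i j : 'I_k, (i <= j)%N -> d 0 j <= d 0 i
    & Z = U *m diag_mx d *m V^T].

Definition is_least (D : set R) (x : R) : Prop := D x /\ lbound D x.
Definition is_greatest (D : set R) (x : R) : Prop := D x /\ ubound D x.

Definition singular_values m n (Z : 'M[R]_(m, n)) : set R :=
  [set s | exists (U : 'M[R]_(m, minn m n)) (d : 'rV[R]_(minn m n))
                  (V : 'M[R]_(n, minn m n)),
           is_svd U d V Z /\ exists i, s = d 0 i].

Definition is_sigma_max m n (Z : 'M[R]_(m, n)) (s : R) : Prop :=
  is_greatest (singular_values Z) s.
Definition is_sigma_min m n (Z : 'M[R]_(m, n)) (s : R) : Prop :=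
  is_least [set t | singular_values Z t /\ t != 0] s.

Definition is_RIC m n p (A : {linear 'M[R]_(m, n) -> 'cV[R]_p}) (k : nat)
    (Rk : R) : Prop :=
  is_least [set c | forall Z : 'M[R]_(m, n), (\rank Z <= k)%N ->
    (1 - c) * frob Z ^+ 2 <= frob (A Z) ^+ 2 <= (1 + c) * frob Z ^+ 2] Rk.

(* A relation rather than a function: with repeated singular values, different
   decompositions of Z may give different thresholded matrices Y. *)
Definition hard_threshold r m n (Z Y : 'M[R]_(m, n)) : Prop :=
  exists (U : 'M[R]_(m, minn m n)) (d : 'rV[R]_(minn m n))
         (V : 'M[R]_(n, minn m n)),
    is_svd U d V Z /\
    Y = U *m diag_mx (\row_i (if (i < r)%N then d 0 i else 0)) *m V^T.

Definition tangent_space r m n (U : 'M[R]_(m, r)) (V : 'M[R]_(n, r)) :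
    set 'M[R]_(m, n) :=
  [set T | exists (L : 'M[R]_(m, r)) (N : 'M[R]_(n, r)),
           T = U *m N^T + L *m V^T].

Definition tproj r m n (U : 'M[R]_(m, r)) (V : 'M[R]_(n, r))
    (Z : 'M[R]_(m, n)) : 'M[R]_(m, n) :=
  U *m U^T *m Z + Z *m V *m V^T - U *m U^T *m Z *m V *m V^T.

Lemma tproj_tangent r m n (U : 'M[R]_(m, r)) (V : 'M[R]_(n, r)) Z :
  tangent_space U V (tproj U V Z).
Proof.
exists (Z *m V - U *m U^T *m Z *m V), (Z^T *m U).
by rewrite trmx_mul trmxK mulmxBl /tproj !mulmxA addrA.
Qed.

Lemma tproj_orth r m n (U : 'M[R]_(m, r)) (V : 'M[R]_(n, r)) Z T :
  U^T *m U = 1%:M -> V^T *m V = 1%:M -> tangent_space U V T ->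
  inner (Z - tproj U V Z) T = 0.
Proof.
move=> hU hV [L [N ->]].
have hB : (Z - tproj U V Z)^T *m U = 0.
  apply: (can_inj (@trmxK _ _ _)); rewrite trmx_mul trmxK trmx0.
  rewrite /tproj mulmxBr mulmxBr mulmxDr !mulmxA hU !mul1mx.
  by rewrite addrK subrr.
have hC : V^T *m (Z - tproj U V Z)^T = 0.
  apply: (can_inj (@trmxK _ _ _)); rewrite trmx_mul !trmxK trmx0.
  rewrite /tproj mulmxBl mulmxBl mulmxDl -!mulmxA hV !mulmx1.
  by rewrite addrAC subrr add0r subrr.
rewrite /inner mulmxDr mulmxA hB mul0mx add0r mulmxA mxtrace_mulC mulmxA hC.
by rewrite mul0mx mxtrace0.
Qed.

(* [X_], [P_], ... are the sequences generated by the algorithm; U_ l and V_ l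
   carry a decomposition of X_ l with r singular values.  Division by zero
   yields 0, so the angle condition holds when one of the two projections
   vanishes; [beta_ l] is 0 in that case anyway. *)
Record restarted_RCG r m n p (A : {linear 'M[R]_(m, n) -> 'cV[R]_p})
    (y : 'cV[R]_p) (kappa1 kappa2 : R)
    (X_ : nat -> 'M[R]_(m, n))
    (U_ : nat -> 'M[R]_(m, r)) (V_ : nat -> 'M[R]_(n, r))
    (G_ P_ W_ : nat -> 'M[R]_(m, n)) (alpha_ beta_ : nat -> R) : Prop := {
  rcg_svd : forall l, exists d, is_svd (U_ l) d (V_ l) (X_ l);
  rcg_grad : forall l, G_ l = adjoint A (y - A (X_ l));
  rcg_beta0 : beta_ 0%N = 0;
  rcg_betaS : forall l,
    let PG := tproj (U_ l.+1) (V_ l.+1) (G_ l.+1) in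
    let PP := tproj (U_ l.+1) (V_ l.+1) (P_ l) in
    beta_ l.+1 =
      if (`|inner PG PP| / (frob PG * frob PP) <= kappa1)
         && (frob PG <= kappa2 * frob PP)
      then - (inner (A PG) (A PP) / frob (A PP) ^+ 2)
      else 0;
  rcg_dir0 : P_ 0%N = tproj (U_ 0%N) (V_ 0%N) (G_ 0%N);
  rcg_dirS : forall l,
    P_ l.+1 = tproj (U_ l.+1) (V_ l.+1) (G_ l.+1)
              + beta_ l.+1 *: tproj (U_ l.+1) (V_ l.+1) (P_ l);
  rcg_step : forall l,
    let PG := tproj (U_ l) (V_ l) (G_ l) in
    let PP := tproj (U_ l) (V_ l) (P_ l) in
    alpha_ l = inner PG PP / frob (A PP) ^+ 2;
  rcg_line : forall l, W_ l = X_ l + alpha_ l *: P_ l;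
  rcg_next : forall l, hard_threshold r (W_ l) (X_ l.+1) }.

End Matrices.

Section Constants.
Variable R : realType.
(* smin = sigma_min(X), nX = ||X||_F *)
Variables (kappa1 kappa2 smin nX R2r R3r : R).

Definition eps_alpha : R := R2r / ((1 - R2r) - kappa1 * (1 + R2r)).
Definition eps_beta : R :=
  kappa2 * R2r / (1 - R2r) + kappa1 * kappa2 / (1 - R2r).
Definition tau1 : R :=
  2 * (R2r + R3r) * (1 + eps_alpha) + 2 * eps_alpha
  + 4 * R2r / smin * nX + eps_beta.
Definition tau2 : R := 2 * eps_beta * (1 + eps_alpha) * (1 + R2r).
Definition gamma : R := tau1 + tau2.
Definition mu : R := (tau1 + Num.sqrt (tau1 ^+ 2 + 4 * tau2)) / 2.

End Constants.

(* Main.v *)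
Require Import Defs.
From HB Require Import structures.
From mathcomp Require Import all_boot all_order all_algebra.
From mathcomp Require Import all_classical all_reals all_analysis.
From mathcomp Require Import ring lra.
Import Order.TTheory GRing.Theory Num.Theory.
Import numFieldNormedType.Exports.
Local Open Scope classical_set_scope.
Local Open Scope ring_scope.

(* Write e_l = |X_l - X|.  Since X_(l+1) is a best rank r approximation of W_l,
   e_(l+1) <= 2 |W_l - X|, and W_l - X splits into three parts.  The component
   of X normal to the tangent space at X_l is at most e_l^2 / sigma_min(X); the
   tangential part is contracted because A is nearly isometric on matrices of
   rank at most 3r and the step length is within eps_alpha of 1; the previous
   direction enters with weight |beta_l| <= eps_beta.  Unrolling the bound on
   the directions gives a recursion dominated by
   e_(l+1) <= tau1 e_l + tau2 e_(l-1), whose characteristic root is mu.  The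
   initial bound |X_0 - X| <= 2 R_2r |X| makes the quadratic term linear. *)

(** * Frobenius inner product, Cauchy-Schwarz and orthogonal projections *)

Section Frobenius.
Set Implicit Arguments.
Unset Strict Implicit.
Context {R : realType}.

Section FixedSize.
Context {m n : nat}.
Implicit Types (x y z : 'M[R]_(m, n)) (a : R).

Lemma innerC x y : inner x y = inner y x.
Proof. by rewrite /inner -mxtrace_tr trmx_mul trmxK. Qed.

Lemma innerDl x y z : inner (x + y) z = inner x z + inner y z.
Proof. by rewrite /inner linearD mulmxDl linearD. Qed.

Lemma innerDr x y z : inner x (y + z) = inner x y + inner x z.
Proof. by rewrite /inner mulmxDr linearD. Qed.

Lemma innerZl a x y : inner (a *: x) y = a * inner x y.
Proof. by rewrite /inner linearZ -scalemxAl linearZ. Qed.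

Lemma innerZr a x y : inner x (a *: y) = a * inner x y.
Proof. by rewrite /inner -scalemxAr linearZ. Qed.

Lemma innerNl x y : inner (- x) y = - inner x y.
Proof. by rewrite -scaleN1r innerZl mulN1r. Qed.

Lemma innerNr x y : inner x (- y) = - inner x y.
Proof. by rewrite -scaleN1r innerZr mulN1r. Qed.

Lemma inner0l x : inner 0 x = 0.
Proof. by rewrite -(scale0r x) innerZl mul0r. Qed.

Lemma inner0r x : inner x 0 = 0.
Proof. by rewrite innerC inner0l. Qed.

Lemma inner_ge0 x : 0 <= inner x x.
Proof.
by rewrite innerE; apply: sumr_ge0 => i _; apply: sumr_ge0 => j _; exact: sqr_ge0.
Qed.

Lemma inner_eq0 x : (inner x x == 0) = (x == 0).
Proof.
apply/eqP/eqP => [x0|->]; last exact: inner0l.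
apply/matrixP => i j; rewrite mxE; apply/eqP; rewrite -sqrf_eq0.
move: x0; rewrite innerE => /eqP.
rewrite psumr_eq0 => [/allP/(_ i (mem_index_enum _))/implyP/(_ isT)|k _].
  rewrite psumr_eq0 => [/allP/(_ j (mem_index_enum _))/implyP/(_ isT)//|k _].
  exact: sqr_ge0.
by apply: sumr_ge0 => l _; exact: sqr_ge0.
Qed.

Lemma frob_ge0 x : 0 <= frob x.
Proof. exact: sqrtr_ge0. Qed.

Lemma sqr_frob x : frob x ^+ 2 = inner x x.
Proof. by rewrite sqr_sqrtr ?inner_ge0. Qed.

Lemma frob_eq0 x : (frob x == 0) = (x == 0).
Proof. by rewrite -sqrf_eq0 sqr_frob inner_eq0. Qed.

Lemma frob0 : frob (0 : 'M[R]_(m, n)) = 0.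
Proof. by apply/eqP; rewrite frob_eq0. Qed.

Lemma frob_gt0 x : (0 < frob x) = (x != 0).
Proof. by rewrite lt0r frob_ge0 andbT frob_eq0. Qed.

Lemma frobN x : frob (- x) = frob x.
Proof. by rewrite /frob innerNl innerNr opprK. Qed.

Lemma frobB x y : frob (x - y) = frob (y - x).
Proof. by rewrite -frobN opprB. Qed.

Lemma frobZ a x : frob (a *: x) = `|a| * frob x.
Proof.
by rewrite /frob innerZl innerZr mulrA -expr2 sqrtrM ?sqr_ge0// sqrtr_sqr.
Qed.

(** Expand the squared norm of [inner x x *: y - inner x y *: x]: it is [inner x x] times the
    claimed difference. *)
Lemma sqr_inner_le x y : inner x y ^+ 2 <= inner x x * inner y y.
Proof.
have [->|x0] := eqVneq x 0; first by rewrite !inner0l expr0n mul0r.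
have xx : 0 < inner x x by rewrite lt0r inner_ge0 inner_eq0 x0.
have := inner_ge0 (inner x x *: y - inner x y *: x).
rewrite !(innerDl, innerDr, innerNl, innerNr, innerZl, innerZr) (innerC y x).
move=> h; rewrite -subr_ge0 -(pmulr_rge0 _ xx); apply: le_trans h _.
by rewrite le_eqVlt; apply/orP; left; apply/eqP; ring.
Qed.

Lemma cauchy_schwarz x y : `|inner x y| <= frob x * frob y.
Proof.
rewrite -(ler_pXn2r (n := 2)) ?nnegrE ?mulr_ge0 ?frob_ge0//.
by rewrite real_normK ?num_real// exprMn !sqr_frob sqr_inner_le.
Qed.

Lemma inner_le x y : inner x y <= frob x * frob y.
Proof. exact: le_trans (ler_norm _) (cauchy_schwarz x y). Qed.

Lemma frob_triangle x y : frob (x + y) <= frob x + frob y.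
Proof.
rewrite -(ler_pXn2r (n := 2)) ?nnegrE ?addr_ge0 ?frob_ge0//.
rewrite sqrrD !sqr_frob innerDl !innerDr (innerC y x).
have := inner_le x y; lra.
Qed.

(** Bounds a norm by testing a matrix against itself; the initial error, the projected gradient and
    the tangential error are all estimated this way. *)
Lemma frob_le_of_dual x (c : R) : 0 <= c -> inner x x <= c * frob x -> frob x <= c.
Proof.
move=> c0; rewrite -sqr_frob expr2.
have [->|x0] := eqVneq x 0; first by rewrite frob0.
by rewrite ler_pM2r ?frob_gt0.
Qed.

End FixedSize.

Lemma inner_mull m n k (L : 'M[R]_(m, n)) (x : 'M[R]_(n, k)) y :
  inner (L *m x) y = inner x (L^T *m y).
Proof. by rewrite /inner trmx_mul mulmxA. Qed.

Lemma frob_tr m n (x : 'M[R]_(m, n)) : frob x^T = frob x.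
Proof. by rewrite /frob /inner trmxK mxtrace_mulC. Qed.

Lemma frob_isometry m n k (V : 'M[R]_(m, n)) (x : 'M[R]_(n, k)) :
  V^T *m V = 1%:M -> frob (V *m x) = frob x.
Proof. by move=> hV; rewrite /frob inner_mull mulmxA hV mul1mx. Qed.

Lemma pythagoras_proj m k (L : 'M[R]_m) (x : 'M[R]_(m, k)) :
  L^T = L -> L *m L = L ->
  frob x ^+ 2 = frob (L *m x) ^+ 2 + frob ((1%:M - L) *m x) ^+ 2.
Proof.
move=> LT LL; have LL0 : (1%:M - L) *m L = 0 by rewrite mulmxBl mul1mx LL subrr.
have xE : x = L *m x + (1%:M - L) *m x by rewrite -mulmxDl addrC subrK mul1mx.
rewrite {1}xE !sqr_frob innerDl !innerDr (innerC ((1%:M - L) *m x)).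
by rewrite !(@inner_mull _ _ _ L) LT !mulmxA mulmxBr mulmx1 LL subrr mul0mx inner0r
  addr0 add0r.
Qed.

Lemma frob_projl m k (L : 'M[R]_m) (x : 'M[R]_(m, k)) :
  L^T = L -> L *m L = L -> frob (L *m x) <= frob x.
Proof.
move=> LT LL; rewrite -(ler_pXn2r (n := 2)) ?nnegrE ?frob_ge0//.
by rewrite [leRHS](pythagoras_proj _ LT LL) lerDl sqr_ge0.
Qed.

Lemma frob_projr m k (L : 'M[R]_m) (x : 'M[R]_(k, m)) :
  L^T = L -> L *m L = L -> frob (x *m L) <= frob x.
Proof.
by move=> LT LL; rewrite -frob_tr trmx_mul LT -(frob_tr x); exact: frob_projl.
Qed.

Lemma frob_tr_isometry m n k (U : 'M[R]_(m, n)) (x : 'M[R]_(m, k)) :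
  U^T *m U = 1%:M -> frob (U^T *m x) <= frob x.
Proof.
move=> hU; rewrite -(frob_isometry _ hU) mulmxA frob_projl//.
  by rewrite trmx_mul trmxK.
by rewrite mulmxA -(mulmxA U) hU mulmx1.
Qed.

Lemma compl_proj_tr m (L : 'M[R]_m) : L^T = L -> (1%:M - L)^T = 1%:M - L.
Proof. by move=> LT; rewrite linearB /= LT trmx1. Qed.

Lemma compl_proj_idem m (L : 'M[R]_m) :
  L *m L = L -> (1%:M - L) *m (1%:M - L) = 1%:M - L.
Proof. by move=> LL; rewrite mulmxBl mul1mx mulmxBr mulmx1 LL subrr subr0. Qed.

(** Cauchy-Schwarz for each entry, a row of [x] against a column of [y], then summation over all
    entries. *)
Lemma frob_mul m n k (x : 'M[R]_(m, n)) (y : 'M[R]_(n, k)) :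
  frob (x *m y) <= frob x * frob y.
Proof.
rewrite -(ler_pXn2r (n := 2)) ?nnegrE ?mulr_ge0 ?frob_ge0//.
rewrite exprMn !sqr_frob !innerE.
have -> : \sum_i \sum_j y i j * y i j = \sum_j \sum_i y i j * y i j
  by rewrite exchange_big.
rewrite mulr_suml; apply: ler_sum => i _.
rewrite mulr_sumr; apply: ler_sum => j _.
have xy : (x *m y) i j = inner (row i x)^T (col j y).
  by rewrite /inner trmxK /mxtrace big_ord1 !mxE; apply: eq_bigr => l _; rewrite !mxE.
have := sqr_inner_le (row i x)^T (col j y).
rewrite -xy expr2 !innerE exchange_big big_ord1.
rewrite [X in _ <= _ * X -> _]exchange_big big_ord1.
move/le_trans; apply; rewrite le_eqVlt; apply/orP; left; apply/eqP.
by congr (_ * _); apply: eq_bigr => l _; rewrite !mxE.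
Qed.

Lemma frob_diag_mull n k (d : 'rV[R]_n) (x : 'M[R]_(n, k)) (c : R) :
  (forall i, 0 <= d 0 i <= c) -> 0 <= c -> frob (diag_mx d *m x) <= c * frob x.
Proof.
move=> dc c0; rewrite -(ler_pXn2r (n := 2)) ?nnegrE ?mulr_ge0 ?frob_ge0//.
rewrite exprMn !sqr_frob !innerE mulr_sumr; apply: ler_sum => i _.
rewrite mulr_sumr; apply: ler_sum => j _.
rewrite mul_diag_mx mxE mulrACA ler_wpM2r ?sqr_ge0//.
by have /andP[d0 d1] := dc i; rewrite expr2; exact: ler_pM.
Qed.

Lemma sqr_frob_diag n (d : 'rV[R]_n) : frob (diag_mx d) ^+ 2 = \sum_i d 0 i ^+ 2.
Proof.
rewrite sqr_frob innerE; apply: eq_bigr => i _.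
rewrite (bigD1 i)//= big1 ?addr0 => [|j ji]; first by rewrite mxE eqxx.
by rewrite mxE eq_sym (negPf ji) mul0r.
Qed.

End Frobenius.

(** * Best rank r approximation by hard thresholding *)

Section LowRankApproximation.
Set Implicit Arguments.
Unset Strict Implicit.
Context {R : realType}.

(** If the rows of K span the left kernel of B^T B, then |B K^T|^2 = <K^T, B^T B K^T> = 0, and full
    column rank of B forces K = 0. *)
Lemma gram_unit m k (B : 'M[R]_(m, k)) : row_full B -> B^T *m B \in unitmx.
Proof.
move=> fB; rewrite -row_free_unit -kermx_eq0; apply/eqP.
set K := kermx _.
have KB : B *m K^T = 0.
  apply/eqP; rewrite -inner_eq0 inner_mull mulmxA.
  have -> : B^T *m B *m K^T = 0.
    by apply: (can_inj (@trmxK _ _ _)); rewrite !trmx_mul !trmxK trmx0 mulmx_ker.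
  by rewrite inner0r.
apply: (can_inj (@trmxK _ _ _)); rewrite trmx0.
by apply: (row_full_inj fB); rewrite KB mulmx0.
Qed.

(** From a rank factorization Z = B C take Pi = B (B^T B)^-1 B^T; cycling the trace gives the trace
    of an identity of size rank Z. *)
Lemma column_projection m n (Z : 'M[R]_(m, n)) :
  exists Pi : 'M[R]_m,
    [/\ Pi^T = Pi, Pi *m Pi = Pi, Pi *m Z = Z & \tr Pi = (\rank Z)%:R].
Proof.
have [B [C [uB ZE]]] : exists (B : 'M[R]_(m, \rank Z)) C,
    B^T *m B \in unitmx /\ B *m C = Z.
  exists (col_base Z), (row_base Z); split; last exact: mulmx_base.
  exact: gram_unit (col_base_full Z).
exists (B *m invmx (B^T *m B) *m B^T); split.
- by rewrite !trmx_mul trmxK trmx_inv trmx_mul trmxK mulmxA.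
- by rewrite -!mulmxA (mulmxA B^T) (mulmxA (B^T *m B)) mulmxV// mul1mx.
- rewrite -[X in _ *m X = _]ZE -!mulmxA (mulmxA B^T) (mulmxA (invmx _)) mulVmx//.
  by rewrite mul1mx.
- by rewrite mxtrace_mulC mulmxA mulmxV// mxtrace1.
Qed.

Lemma frob_svd_diag k m n (U : 'M[R]_(m, k)) (d : 'rV[R]_k) (V : 'M[R]_(n, k)) :
  U^T *m U = 1%:M -> V^T *m V = 1%:M ->
  frob (U *m diag_mx d *m V^T) ^+ 2 = \sum_i d 0 i ^+ 2.
Proof.
move=> hU hV; rewrite -frob_tr trmx_mul trmxK frob_isometry// frob_tr.
by rewrite frob_isometry// sqr_frob_diag.
Qed.

Lemma truncation_error r k m n (U : 'M[R]_(m, k)) d (V : 'M[R]_(n, k))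
    (Z : 'M[R]_(m, n)) :
  is_svd U d V Z ->
  frob (U *m diag_mx (\row_i (if (i < r)%N then d 0 i else 0)) *m V^T - Z) ^+ 2 =
  \sum_(i < k | (r <= i)%N) d 0 i ^+ 2.
Proof.
case=> hU hV _ _ ->; rewrite -mulmxBl -mulmxBr -linearB /= frob_svd_diag//.
rewrite [RHS]big_mkcond; apply: eq_bigr => i _; rewrite !mxE ltnNge.
by case: (r <= i)%N => /=; rewrite ?subrr ?expr0n// sub0r sqrrN.
Qed.

(* With Pi the projection onto the columns of Y, the squared distance is at
   least |Z|^2 - |Pi Z|^2, and |Pi Z|^2 is a sum of the d_i^2 with weights
   w_i in [0, 1] of total mass at most r. *)
Lemma eckart_young r m n (Z Y X : 'M[R]_(m, n)) :
  hard_threshold r Z Y -> (\rank X <= r)%N -> frob (Y - Z) <= frob (X - Z).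
Proof.
move=> [U [d [V [svd ->]]]] rX.
rewrite -(ler_pXn2r (n := 2)) ?nnegrE ?frob_ge0// truncation_error//.
case: svd => hU hV d0 dd ->.
have [Pi [PiT PiPi PiX trPi]] := column_projection X.
set Z' := U *m diag_mx d *m V^T; rewrite frobB.
apply: (@le_trans _ _ (frob ((1%:M - Pi) *m (Z' - X)) ^+ 2)); last first.
  by rewrite [leRHS](pythagoras_proj _ PiT PiPi) lerDr sqr_ge0.
have -> : (1%:M - Pi) *m (Z' - X) = (1%:M - Pi) *m Z'.
  by rewrite mulmxBr [_ *m X]mulmxBl PiX mul1mx subrr subr0.
pose w i := frob (Pi *m col i U) ^+ 2.
have colM i : Pi *m col i U = col i (Pi *m U) by rewrite !colE mulmxA.
have w1 i : w i <= 1.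
  have -> : 1 = frob (col i U) ^+ 2 :> R.
    rewrite sqr_frob innerE; have := congr1 (fun M : 'M[R]_(minn m n) => M i i) hU.
    rewrite !mxE eqxx mulr1n => <-; apply: eq_bigr => j _.
    by rewrite big_ord1 !mxE.
  by rewrite ler_pXn2r ?nnegrE ?frob_ge0// frob_projl.
have PiZ : frob (Pi *m Z') ^+ 2 = \sum_i d 0 i ^+ 2 * w i.
  rewrite /Z' mulmxA -frob_tr trmx_mul trmxK frob_isometry// frob_tr mulmxA.
  rewrite sqr_frob innerE exchange_big; apply: eq_bigr => j _.
  rewrite /w sqr_frob innerE mulr_sumr; apply: eq_bigr => i _.
  rewrite big_ord1 mul_mx_diag mxE colM [in RHS]mxE; ring.
have sw : \sum_i w i <= r%:R.
  apply: (@le_trans _ _ (\tr Pi)); last by rewrite trPi ler_nat.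
  have -> : \sum_i w i = frob (U^T *m Pi) ^+ 2.
    rewrite -frob_tr trmx_mul trmxK PiT sqr_frob innerE exchange_big.
    apply: eq_bigr => j _.
    rewrite /w sqr_frob innerE; apply: eq_bigr => i _.
    by rewrite big_ord1 colM !mxE.
  have -> : \tr Pi = frob Pi ^+ 2 by rewrite sqr_frob /inner PiT PiPi.
  by rewrite ler_pXn2r ?nnegrE ?frob_ge0// frob_tr_isometry.
have := pythagoras_proj Z' PiT PiPi.
rewrite {1}/Z' frob_svd_diag// PiZ => /eqP; rewrite addrC -subr_eq -sumrB => /eqP <-.
rewrite big_mkcond -subr_ge0 -sumrB.
have [rk|kr] := ltnP r (minn m n); last first.
  apply: sumr_ge0 => i _; rewrite leqNgt (leq_trans (ltn_ord i) kr) subr0.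
  by rewrite -[X in X - _]mulr1 -mulrBr mulr_ge0 ?sqr_ge0// subr_ge0.
(* c is the square of the first discarded singular value. Every term of the difference is at least c
   ([i < r] - w_i), and these lower bounds sum to c (r - sum w) >= 0. *)
pose c := d 0 (Ordinal rk) ^+ 2.
have count : \sum_(i < minn m n) (i < r)%N%:R = r%:R :> R.
  rewrite (eq_bigr (fun i : 'I_(minn m n) => if (i < r)%N then 1 else 0)) => [|i _].
    by rewrite -big_mkcond (big_ord_narrow (ltnW rk)) sumr_const card_ord.
  by case: (i < r)%N.
apply: (@le_trans _ _ (\sum_(i < minn m n) c * ((i < r)%N%:R - w i))).
  by rewrite -mulr_sumr mulr_ge0 ?sqr_ge0// sumrB count subr_ge0.
apply: ler_sum => i _.
case: (ltnP i r) => ir.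
  rewrite subr0 -[X in _ <= X - _]mulr1 -mulrBr ler_wpM2r ?subr_ge0//.
  by rewrite ler_pXn2r ?nnegrE ?d0 ?dd// ltnW.
rewrite sub0r addrAC subrr sub0r mulrN lerN2 ler_wpM2r ?sqr_ge0//.
by rewrite ler_pXn2r ?nnegrE ?d0 ?dd.
Qed.

(** Truncating X at its own rank is at least as good as X itself, so the truncation error, a sum of
    squares of the tail, is zero. *)
Lemma svd_tail0 k m n (U : 'M[R]_(m, k)) d (V : 'M[R]_(n, k)) (X : 'M[R]_(m, n)) :
  k = minn m n -> is_svd U d V X -> forall i : 'I_k, (\rank X <= i)%N -> d 0 i = 0.
Proof.
move=> kE; subst k => svd i ri.
have Y : hard_threshold (\rank X) X
    (U *m diag_mx (\row_i (if (i < \rank X)%N then d 0 i else 0)) *m V^T).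
  by exists U, d, V.
have := eckart_young Y (leqnn _).
rewrite subrr frob0 -(ler_pXn2r (n := 2)) ?nnegrE ?frob_ge0//.
rewrite (truncation_error _ svd) expr0n /=.
rewrite (bigD1 i)//=; set s := (X in _ + X) => h.
have s0 : 0 <= s by apply: sumr_ge0 => j _; exact: sqr_ge0.
apply/eqP; rewrite -sqrf_eq0 eq_le sqr_ge0 andbT.
by apply: le_trans h; rewrite lerDl.
Qed.

Lemma svd_rank k m n (U : 'M[R]_(m, k)) d (V : 'M[R]_(n, k)) Z :
  is_svd U d V Z -> (\rank Z <= k)%N.
Proof.
by case=> _ _ _ _ ->; rewrite -mulmxA (leq_trans (mxrankM_maxl _ _))// rank_leq_col.
Qed.

End LowRankApproximation.

(** * Tangent space at a rank r matrix and its orthogonal projection *)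

Section TangentSpace.
Set Implicit Arguments.
Unset Strict Implicit.
Context {R : realType} {r m n : nat}.
Variables (U : 'M[R]_(m, r)) (V : 'M[R]_(n, r)).

Lemma tangent_lin (a b : R) x y :
  tangent_space U V x -> tangent_space U V y -> tangent_space U V (a *: x + b *: y).
Proof.
move=> [L [N ->]] [L' [N' ->]]; exists (a *: L + b *: L'), (a *: N + b *: N').
rewrite [(_ + _)^T]linearD /= !linearZ /= mulmxDl mulmxDr -!scalemxAl -!scalemxAr
  !scalerDr.
by rewrite addrACA.
Qed.

Lemma tangent_rank x : tangent_space U V x -> (\rank x <= 2 * r)%N.
Proof.
move=> [L [N ->]]; rewrite mul2n -addnn (leq_trans (mxrank_add _ _))// leq_add//.
  by rewrite (leq_trans (mxrankM_maxl _ _))// rank_leq_col.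
by rewrite (leq_trans (mxrankM_maxl _ _))// rank_leq_col.
Qed.

Lemma normal_componentE Z :
  Z - tproj U V Z = (1%:M - U *m U^T) *m Z *m (1%:M - V *m V^T).
Proof.
rewrite mulmxBl mul1mx mulmxBr mulmx1 mulmxBl /tproj !mulmxA.
by rewrite -!addrA -!opprD; congr (_ - _);
  rewrite addrCA addrA addrC -!addrA addrC -!addrA.
Qed.

Lemma normal_rank (Z : 'M[R]_(m, n)) : (\rank (Z - tproj U V Z)%R <= \rank Z)%N.
Proof.
by rewrite normal_componentE (leq_trans (mxrankM_maxl _ _))// mxrankM_maxr.
Qed.

(** The factor 1 - U U^T annihilates Y, so the normal part of the error X - Y is that of X alone and
    its rank is at most that of X. *)
Lemma normal_svd d (X Y : 'M[R]_(m, n)) :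
  is_svd U d V Y -> (X - Y) - tproj U V (X - Y) = X - tproj U V X.
Proof.
case=> hU _ _ _ ->; rewrite !normal_componentE; congr (_ *m _).
rewrite mulmxBr -[RHS]subr0; congr (_ - _).
by rewrite !mulmxA mulmxBl mul1mx -(mulmxA U) hU mulmx1 subrr !mul0mx.
Qed.

Hypotheses (hU : U^T *m U = 1%:M) (hV : V^T *m V = 1%:M).

Lemma inner_tproj Z T : tangent_space U V T -> inner (tproj U V Z) T = inner Z T.
Proof.
move=> hT; apply/eqP; rewrite -subr_eq0 -opprB oppr_eq0 -innerNl -innerDl.
by rewrite tproj_orth.
Qed.

(** The residual of T is tangent and orthogonal to the tangent space, hence zero. *)
Lemma tproj_id T : tangent_space U V T -> tproj U V T = T.
Proof.
move=> hT; apply/eqP; rewrite eq_sym -subr_eq0 -inner_eq0 tproj_orth//.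
have := tangent_lin 1 (-1) hT (tproj_tangent U V T).
by rewrite scaleN1r scale1r.
Qed.

Lemma pythagoras_tproj Z :
  frob Z ^+ 2 = frob (tproj U V Z) ^+ 2 + frob (Z - tproj U V Z) ^+ 2.
Proof.
have orth : inner (Z - tproj U V Z) (tproj U V Z) = 0.
  by rewrite tproj_orth//; exact: tproj_tangent.
rewrite -{1}(subrK (tproj U V Z) Z) !sqr_frob; move: orth.
move: (tproj U V Z) (Z - tproj U V Z) => T N orth.
by rewrite innerDl !innerDr (innerC T N) orth addr0 add0r addrC.
Qed.

Lemma frob_tproj Z : frob (tproj U V Z) <= frob Z.
Proof.
rewrite -(ler_pXn2r (n := 2)) ?nnegrE ?frob_ge0//.
by rewrite [leRHS]pythagoras_tproj lerDl sqr_ge0.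
Qed.

Lemma frob_normal Z : frob (Z - tproj U V Z) <= frob Z.
Proof.
rewrite -(ler_pXn2r (n := 2)) ?nnegrE ?frob_ge0//.
by rewrite [leRHS]pythagoras_tproj lerDr sqr_ge0.
Qed.

End TangentSpace.

(** * Pseudo-inverse and the quadratic bound on the normal component *)

Section SmallestSingularValue.
Set Implicit Arguments.
Unset Strict Implicit.
Context {R : realType}.

Lemma sigma_min_gt0 m n (X : 'M[R]_(m, n)) s : is_sigma_min X s -> 0 < s.
Proof.
move=> [[[U [d [V [[_ _ d0 _ _] [i ->]]]]] s0] _].
by rewrite lt0r s0 d0.
Qed.

(** M is the Moore-Penrose inverse V diag(1/d) U^T. Since 0^-1 = 0, zero singular values contribute
    nothing, and the nonzero ones are at least s. *)
Lemma pseudo_inverse m n (X : 'M[R]_(m, n)) s : is_sigma_min X s ->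
  exists M : 'M[R]_(n, m), X *m M *m X = X /\
    forall k (Z : 'M[R]_(m, k)), frob (M *m Z) <= frob Z / s.
Proof.
move=> hs; have s0 := sigma_min_gt0 hs.
case: hs => [[[U [d [V [svd _]]]] _] lb].
have ds i : d 0 i != 0 -> s <= d 0 i.
  by move=> di; apply: lb; split => //; exists U, d, V; split => //; exists i.
case: svd => hU hV d0 _ ->.
exists (V *m diag_mx (\row_i (d 0 i)^-1) *m U^T); split => [|k Z].
  rewrite -!mulmxA (mulmxA U^T) hU mul1mx (mulmxA V^T) hV mul1mx.
  congr (_ *m _); rewrite !mulmxA; congr (_ *m _).
  apply/matrixP => i j; rewrite !mul_diag_mx mul_mx_diag !mxE.
  case: (i =P j) => [->|_]; last by rewrite !mulr0n !(mulr0, mul0r).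
  rewrite mulr1n; have [->|dj] := eqVneq (d 0 j) 0; first by rewrite !mul0r.
  by rewrite divff// mul1r.
rewrite -!mulmxA frob_isometry// mulrC.
apply: (@le_trans _ _ (s^-1 * frob (U^T *m Z))).
  apply: frob_diag_mull => [i|]; last by rewrite invr_ge0 ltW.
  rewrite mxE invr_ge0 d0 /=; have [->|di] := eqVneq (d 0 i) 0.
    by rewrite invr0 invr_ge0 ltW.
  by rewrite lef_pV2 ?posrE ?ds// (lt_le_trans s0)// ds.
by rewrite ler_wpM2l ?frob_tr_isometry// invr_ge0 ltW.
Qed.

(* X = X M X with M a pseudo-inverse, so the normal component of X at Y is
   (1 - U U^T)(X - Y) M (X - Y)(1 - V V^T). *)
Lemma frob_normal_quadratic r m n (U : 'M[R]_(m, r)) (V : 'M[R]_(n, r)) d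
    (X Y : 'M[R]_(m, n)) s :
  is_sigma_min X s -> is_svd U d V Y ->
  frob (X - tproj U V X) <= frob (Y - X) ^+ 2 / s.
Proof.
move=> hs [hU hV _ _ YE]; have s0 := sigma_min_gt0 hs.
have [M [XMX hM]] := pseudo_inverse hs; rewrite normal_componentE.
set L := 1%:M - U *m U^T; set N := 1%:M - V *m V^T.
have LT : L^T = L by apply: compl_proj_tr; rewrite trmx_mul trmxK.
have LL : L *m L = L by apply: compl_proj_idem; rewrite mulmxA -(mulmxA U) hU mulmx1.
have NT : N^T = N by apply: compl_proj_tr; rewrite trmx_mul trmxK.
have NN : N *m N = N by apply: compl_proj_idem; rewrite mulmxA -(mulmxA V) hV mulmx1.
have LY : L *m Y = 0.
  by rewrite YE !mulmxA mulmxBl mul1mx -(mulmxA U) hU mulmx1 subrr !mul0mx.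
have YN : Y *m N = 0.
  by rewrite YE -!mulmxA mulmxBr mulmx1 (mulmxA V^T) hV mul1mx subrr !mulmx0.
have -> : L *m X *m N = L *m (X - Y) *m (M *m ((X - Y) *m N)).
  by rewrite (mulmxBr L) LY (mulmxBl X) YN !subr0 -{1}XMX !mulmxA.
rewrite frobB expr2 -mulrA; apply: le_trans (frob_mul _ _) _.
apply: ler_pM; rewrite ?frob_ge0// ?frob_projl//.
apply: le_trans (hM _ _) _.
by rewrite ler_wpM2r ?invr_ge0 ?(ltW s0)// frob_projr.
Qed.

End SmallestSingularValue.

(** * Restricted isometry, its polarized form and the initial error *)

Section RestrictedIsometry.
Set Implicit Arguments.
Unset Strict Implicit.
Context {R : realType} {m n p : nat}.
Variable A : {linear 'M[R]_(m, n) -> 'cV[R]_p}.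

(** Stated for a single matrix, so that it can be assumed on the span of two matrices instead of on
    a whole rank class. *)
Definition near_isometric (c : R) (Z : 'M[R]_(m, n)) : Prop :=
  (1 - c) * frob Z ^+ 2 <= frob (A Z) ^+ 2 <= (1 + c) * frob Z ^+ 2.

(** Polarization with the rescaled vectors |y| x + |x| y and |y| x - |x| y, whose summands have
    equal length; the common factor |x| |y| is then cancelled. *)
Lemma near_isometric_bilinear (c : R) (x y : 'M[R]_(m, n)) :
  (forall a b, near_isometric c (a *: x + b *: y)) ->
  `|inner (A x) (A y) - inner x y| <= c * (frob x * frob y).
Proof.
move=> h.
have [->|x0] := eqVneq x 0.
  by rewrite linear0 !inner0l frob0 mul0r mulr0 subr0 normr0.
have [->|y0] := eqVneq y 0.
  by rewrite linear0 !inner0r frob0 !mulr0 subr0 normr0.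
have xy : 0 < frob x * frob y by rewrite mulr_gt0 ?frob_gt0.
have /andP[] := h (frob y) (frob x); have /andP[] := h (frob y) (- frob x).
rewrite !linearD !linearZ /= !sqr_frob.
rewrite !(innerDl, innerDr, innerZl, innerZr) -!sqr_frob.
rewrite (innerC y x) (innerC (A y) (A x)).
move: xy; set a := frob x; set b := frob y; set u := frob (A x); set v := frob (A y).
set s := inner x y; set t := inner (A x) (A y) => xy h1 h2 h3 h4.
rewrite ler_norml -(ler_pM2l xy) -[X in _ && X](ler_pM2l xy); apply/andP; split; nra.
Qed.

Definition rip (k : nat) (c : R) : Prop :=
  forall Z : 'M[R]_(m, n), (\rank Z <= k)%N -> near_isometric c Z.

Lemma is_RIC_rip k c : is_RIC A k c -> rip k c.
Proof. by case. Qed.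

Lemma is_RIC_ge0 k c (Z : 'M[R]_(m, n)) :
  is_RIC A k c -> (\rank Z <= k)%N -> Z != 0 -> 0 <= c.
Proof.
move=> /is_RIC_rip h rZ Z0; have /andP[h1 h2] := h _ rZ.
have := le_trans h1 h2; rewrite ler_pM2r ?exprn_gt0 ?frob_gt0//; lra.
Qed.

Lemma is_RIC_mono k l c d : (k <= l)%N -> is_RIC A k c -> is_RIC A l d -> c <= d.
Proof.
by move=> kl [_ lb] /is_RIC_rip h; apply: lb => Z rZ; exact: h (leq_trans rZ kl).
Qed.

Lemma inner_adjoint v Z : inner (adjoint A v) Z = inner v (A Z).
Proof. by rewrite innerC -adjointP innerC. Qed.

(** Square roots are avoided at the cost of sharpness: (1 - c)^2 <= 1 - c here, and 1 + c <= (1 +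
    c)^2 in the upper bound. *)
Lemma near_isometric_lower c Z : 0 <= c < 1 -> near_isometric c Z ->
  (1 - c) * frob Z <= frob (A Z).
Proof.
move=> c01 /andP[h _]; have Z0 := frob_ge0 Z.
rewrite -(ler_pXn2r (n := 2)) ?nnegrE ?frob_ge0 ?mulr_ge0//; last lra.
rewrite exprMn; apply: le_trans h; rewrite ler_wpM2r ?sqr_ge0//; nra.
Qed.

Lemma near_isometric_upper c Z : 0 <= c -> near_isometric c Z ->
  frob (A Z) <= (1 + c) * frob Z.
Proof.
move=> c0 /andP[_ h]; have Z0 := frob_ge0 Z.
rewrite -(ler_pXn2r (n := 2)) ?nnegrE ?frob_ge0 ?mulr_ge0//; last lra.
rewrite exprMn; apply: le_trans h _; rewrite ler_wpM2r ?sqr_ge0//; nra.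
Qed.

(* Optimality of Y gives |Y - X|^2 <= 2 <Y - X, A^*A X - X>, and the right-hand
   side is controlled by the restricted isometry property on span(X, Y). *)
Lemma initial_error r c (X Y : 'M[R]_(m, n)) :
  rip (2 * r) c -> 0 <= c -> (\rank X <= r)%N -> (\rank Y <= r)%N ->
  hard_threshold r (adjoint A (A X)) Y -> frob (Y - X) <= 2 * c * frob X.
Proof.
move=> hA c0 rX rY hY.
apply: frob_le_of_dual; first by rewrite !mulr_ge0 ?frob_ge0.
have := eckart_young hY rX.
rewrite -(ler_pXn2r (n := 2)) ?nnegrE ?frob_ge0// !sqr_frob.
have hb : `|inner (A (Y - X)) (A X) - inner (Y - X) X| <= c * (frob (Y - X) * frob X).
  apply: near_isometric_bilinear => a b; apply: hA.
  (* A combination a (Y - X) + b X regroups as a Y + (b - a) X, of rank at most 2r. *)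
  rewrite scalerBr -addrA -scaleNr -scalerDl mul2n -addnn.
  by rewrite (leq_trans (mxrank_add _ _))// leq_add// (leq_trans (mxrank_scale _ _)).
have := ler_norm (inner (A (Y - X)) (A X) - inner (Y - X) X).
move=> /le_trans/(_ hb); move: {hb}(frob (Y - X)) => f.
rewrite linearB !(innerDl, innerDr, innerNl, innerNr) /= !inner_adjoint.
rewrite !(innerC _ (adjoint _ _)) !inner_adjoint.
rewrite (innerC Y X) (innerC (A Y)); lra.
Qed.

End RestrictedIsometry.

(** * Conjugate direction, its weight and the step length *)

Section SearchDirection.
Set Implicit Arguments.
Unset Strict Implicit.
Context {R : realType} {m n p : nat}.
Variable A : {linear 'M[R]_(m, n) -> 'cV[R]_p}.
Variables (c kappa1 kappa2 : R).
Hypotheses (c01 : 0 <= c < 1) (k1 : 0 <= kappa1) (k2 : 0 <= kappa2).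
Hypothesis den : 0 < (1 - c) - kappa1 * (1 + c).

Lemma eps_alpha_ge0 : 0 <= eps_alpha kappa1 c.
Proof. by rewrite /eps_alpha divr_ge0 ?(ltW den)//; case/andP: c01. Qed.

Lemma eps_beta_ge0 : 0 <= eps_beta kappa1 kappa2 c.
Proof.
have [c0 c1] := andP c01; have d0 : 0 <= 1 - c by rewrite subr_ge0 ltW.
by rewrite /eps_beta addr_ge0// divr_ge0// mulr_ge0.
Qed.

(* x and q stand for the projected gradient and the projected previous direction. *)
Variables (x q : 'M[R]_(m, n)).
Hypothesis hnear : forall a b, near_isometric A c (a *: x + b *: q).

Let near_x : near_isometric A c x.
Proof. by have := hnear 1 0; rewrite scale1r scale0r addr0. Qed.

Let near_q : near_isometric A c q.
Proof. by have := hnear 0 1; rewrite scale1r scale0r add0r. Qed.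

(** Polarization and the angle condition give |<Ax, Aq>| <= (c + kappa1) |x| |q|; the length
    condition and |Aq|^2 >= (1 - c) |q|^2 then produce kappa2 (c + kappa1) / (1 - c), which is
    [eps_beta]. *)
Lemma beta_bound :
  `|inner x q| <= kappa1 * (frob x * frob q) -> frob x <= kappa2 * frob q ->
  `|inner (A x) (A q) / frob (A q) ^+ 2| <= eps_beta kappa1 kappa2 c.
Proof.
move=> h1 h2; have [q0|q0] := eqVneq q 0.
  by rewrite q0 linear0 inner0r mul0r normr0 eps_beta_ge0.
have qq : 0 < frob q by rewrite frob_gt0.
have [c0 c1] := andP c01.
have /andP[lo _] := near_q.
have Aq : 0 < frob (A q) ^+ 2.
  by apply: lt_le_trans lo; rewrite mulr_gt0 ?exprn_gt0// subr_gt0.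
have hb := near_isometric_bilinear hnear.
have ht : `|inner (A x) (A q)| <= (c + kappa1) * (frob x * frob q).
  rewrite -[inner (A x) _](subrK (inner x q)); apply: le_trans (ler_normD _ _) _.
  by rewrite mulrDl lerD.
rewrite normrM normfV (ger0_norm (ltW Aq)) ler_pdivrMr//.
apply: le_trans ht _.
apply: (@le_trans _ _ ((c + kappa1) * (kappa2 * frob q * frob q))).
  by rewrite ler_wpM2l ?addr_ge0// ler_wpM2r ?frob_ge0.
apply: (@le_trans _ _ (eps_beta kappa1 kappa2 c * ((1 - c) * frob q ^+ 2))).
  rewrite le_eqVlt; apply/orP; left; apply/eqP; rewrite /eps_beta; field; lra.
by rewrite ler_wpM2l// eps_beta_ge0.
Qed.

Variable beta : R.
Hypothesis hbeta : beta = 0 \/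
  `|inner x q| <= kappa1 * (frob x * frob q) /\
  beta = - (inner (A x) (A q) / frob (A q) ^+ 2).

(** After a restart the direction is x itself; otherwise this [beta] makes the image of the
    direction orthogonal to A q. *)
Lemma direction_conjugate :
  inner (A x) (A (x + beta *: q)) = frob (A (x + beta *: q)) ^+ 2.
Proof.
case: hbeta => [->|[_ ->]]; first by rewrite scale0r addr0 sqr_frob.
rewrite linearD linearZ /= !sqr_frob; move: (A x) (A q) => u v.
have [->|v0] := eqVneq v 0; first by rewrite scaler0 addr0.
rewrite !(innerDl, innerDr, innerZl, innerZr) (innerC v u).
by field; rewrite inner_eq0.
Qed.

(** Testing the direction against x leaves at least |x|^2 - kappa1 |beta| |q| |x|, by the angle
    condition, and |beta| |q| is at most (1 + c) / (1 - c) times |x|. *)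
Lemma direction_lower :
  ((1 - c) - kappa1 * (1 + c)) * frob x <= (1 - c) * frob (x + beta *: q).
Proof.
have [c0 c1] := andP c01; have x0 := frob_ge0 x.
case: hbeta => [->|[h1 hb]].
  by rewrite scale0r addr0 ler_wpM2r// gerBl mulr_ge0// addr_ge0.
have [xz|xx] := eqVneq x 0.
  by rewrite xz frob0 mulr0 mulr_ge0 ?frob_ge0//; lra.
have {}xx : 0 < frob x by rewrite frob_gt0.
rewrite -(ler_pM2r xx) -[leRHS]mulrA.
(* Cauchy-Schwarz gives |beta| |Aq| <= |Ax|; near isometry transfers this to q and x. *)
have hbq : (1 - c) * (`|beta| * frob q) <= (1 + c) * frob x.
  rewrite hb normrN normrM normfV (ger0_norm (sqr_ge0 _)).
  have [Aq|Aq] := eqVneq (frob (A q)) 0.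
    by rewrite Aq expr0n invr0 mulr0 mul0r mulr0 mulr_ge0//; lra.
  have {}Aq : 0 < frob (A q) by rewrite lt0r Aq frob_ge0.
  have lo := near_isometric_lower c01 near_q.
  have up := near_isometric_upper c0 near_x.
  have cs := cauchy_schwarz (A x) (A q).
  set B := `|_|.
  rewrite (_ : _ * _ = (1 - c) * frob q * (B / frob (A q) ^+ 2)); last by ring.
  apply: (@le_trans _ _ (frob (A q) * (B / frob (A q) ^+ 2))).
    by rewrite ler_wpM2r// divr_ge0 ?sqr_ge0// /B.
  have -> : frob (A q) * (B / frob (A q) ^+ 2) = B / frob (A q) by field; rewrite gt_eqF.
  by rewrite ler_pdivrMr//; apply: le_trans cs _; rewrite ler_wpM2r// frob_ge0.
have := inner_le (x + beta *: q) x.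
rewrite innerDl innerZl -sqr_frob (innerC q x) => hi.
have hn : - (beta * inner x q) <= `|beta| * (kappa1 * (frob x * frob q)).
  by apply: le_trans (ler_norm _) _; rewrite normrN normrM ler_wpM2l.
have : kappa1 * frob x * ((1 - c) * (`|beta| * frob q))
    <= kappa1 * frob x * ((1 + c) * frob x).
  by rewrite ler_wpM2l// mulr_ge0.
have : (1 - c) * (frob x ^+ 2 + beta * inner x q)
    <= (1 - c) * (frob (x + beta *: q) * frob x).
  by rewrite ler_wpM2l//; lra.
have : (1 - c) * (- (beta * inner x q))
    <= (1 - c) * (`|beta| * (kappa1 * (frob x * frob q))).
  by rewrite ler_wpM2l//; lra.
nra.
Qed.

(* When the direction vanishes the quotient is 0, but any step length may be
   used instead. *)
Lemma step_length :
  exists2 alpha, `|alpha - 1| <= eps_alpha kappa1 c &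
    (inner x (x + beta *: q) / frob (A (x + beta *: q)) ^+ 2) *: (x + beta *: q)
      = alpha *: (x + beta *: q).
Proof.
have [c0 c1] := andP c01.
have hd := direction_lower; have hc := direction_conjugate.
have near1 : near_isometric A c (x + beta *: q).
  by have := hnear 1 beta; rewrite scale1r.
have hb : `|inner (A x) (A (x + beta *: q)) - inner x (x + beta *: q)|
    <= c * (frob x * frob (x + beta *: q)).
  apply: near_isometric_bilinear => a b.
  by rewrite scalerDr addrA -scalerDl scalerA; exact: hnear.
move: hd hc near1 hb; set z := x + beta *: q => hd hc near1 hb.
have [->|z0] := eqVneq z 0.
  by exists 1; rewrite ?scaler0// subrr normr0 eps_alpha_ge0.
exists (inner x z / frob (A z) ^+ 2) => //.
have zz : 0 < frob z by rewrite frob_gt0.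
have /andP[lo _] := near1.
have Az : 0 < frob (A z) ^+ 2.
  by apply: lt_le_trans lo; rewrite mulr_gt0 ?exprn_gt0// subr_gt0.
(* Conjugacy lets <Ax, Az> replace |Az|^2, so the deviation from 1 is exactly a polarization
   error. *)
have -> : inner x z / frob (A z) ^+ 2 - 1
    = - ((inner (A x) (A z) - inner x z) / frob (A z) ^+ 2).
  by rewrite hc; field; rewrite -sqrf_eq0 gt_eqF.
rewrite normrN normrM normfV (ger0_norm (ltW Az)) ler_pdivrMr//.
apply: le_trans hb _.
apply: (@le_trans _ _ (eps_alpha kappa1 c * ((1 - c) * frob z ^+ 2))); last first.
  by rewrite ler_wpM2l// eps_alpha_ge0.
rewrite /eps_alpha mulrAC ler_pdivlMr// -!mulrA ler_wpM2l//.
have := ler_wpM2r (ltW zz) hd; nra.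
Qed.

End SearchDirection.

(** * Projected gradient and tangential error at one iterate *)

Section OneStep.
Set Implicit Arguments.
Unset Strict Implicit.
Context {R : realType} {r m n p : nat}.
Variable A : {linear 'M[R]_(m, n) -> 'cV[R]_p}.
Variables (c2 c3 : R).
Hypotheses (hc2 : 0 <= c2) (hc3 : 0 <= c3).
Hypotheses (rip2 : rip A (2 * r) c2) (rip3 : rip A (3 * r) c3).
Variables (U : 'M[R]_(m, r)) (V : 'M[R]_(n, r)) (d : 'rV[R]_r) (X Y : 'M[R]_(m, n)).
Hypotheses (hY : is_svd U d V Y) (rX : (\rank X <= r)%N).

Let hU : U^T *m U = 1%:M. Proof. by case: hY. Qed.
Let hV : V^T *m V = 1%:M. Proof. by case: hY. Qed.

Let PG := tproj U V (adjoint A (A X - A Y)).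

Lemma tangent_near a b x y : tangent_space U V x -> tangent_space U V y ->
  near_isometric A c2 (a *: x + b *: y).
Proof.
move=> hx hy; apply: rip2; apply: (@tangent_rank _ _ _ _ U V).
exact: tangent_lin.
Qed.

Lemma inner_projected_gradient T :
  tangent_space U V T -> inner PG T = inner (A (X - Y)) (A T).
Proof. by move=> hT; rewrite /PG inner_tproj// inner_adjoint linearB. Qed.

Lemma rank_error : (\rank (X - Y)%R <= 2 * r)%N.
Proof.
rewrite mul2n -addnn (leq_trans (mxrank_add _ _))// leq_add// mxrank_opp.
exact: svd_rank hY.
Qed.

(** Testing the gradient against itself gives <A(X - Y), A PG>; both arguments have rank at most
    2r. *)
Lemma projected_gradient_bound : frob PG <= (1 + c2) * frob (Y - X).
Proof.
rewrite (frobB Y); have hT : tangent_space U V PG by exact: tproj_tangent.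
apply: frob_le_of_dual; first by rewrite mulr_ge0 ?frob_ge0// addr_ge0.
rewrite inner_projected_gradient//; apply: le_trans (inner_le _ _) _.
have near1 : near_isometric A c2 PG by apply: rip2; exact: tangent_rank hT.
have near2 : near_isometric A c2 (X - Y) by apply/rip2/rank_error.
have /andP[_ h1] := near1; have /andP[_ h2] := near2.
rewrite -(ler_pXn2r (n := 2)) ?nnegrE ?mulr_ge0 ?frob_ge0 ?addr_ge0//.
rewrite exprMn.
apply: (@le_trans _ _ ((1 + c2) * frob (X - Y) ^+ 2 * ((1 + c2) * frob PG ^+ 2))).
  by apply: ler_pM; rewrite ?sqr_ge0.
by rewrite le_eqVlt; apply/orP; left; apply/eqP; ring.
Qed.

(** Split X - Y into its tangential part E and normal part N and test T against itself. The gradient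
    sees both parts through A: E contributes a deviation [c2], while N is orthogonal to T and leaks
    only through [c3]. *)
Lemma tangential_error alpha :
  frob (tproj U V (X - Y) - alpha *: PG)
    <= (`|alpha - 1| + `|alpha| * (c2 + c3)) * frob (Y - X).
Proof.
set T := _ - _.
have hT : tangent_space U V T.
  rewrite /T -scaleNr -[tproj _ _ (X - Y)]scale1r.
  by apply: tangent_lin; exact: tproj_tangent.
set E := tproj U V (X - Y); set N := (X - Y) - E.
have hN : N = X - tproj U V X by exact: normal_svd hY.
have hE : tangent_space U V E by exact: tproj_tangent.
have E_le : frob E <= frob (Y - X) by rewrite frobB frob_tproj.
have N_le : frob N <= frob (Y - X) by rewrite frobB frob_normal.
have bE : `|inner (A E) (A T) - inner E T| <= c2 * (frob E * frob T).
  by apply: near_isometric_bilinear => a b; exact: tangent_near.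
have bN : `|inner (A N) (A T) - inner N T| <= c3 * (frob N * frob T).
  apply: near_isometric_bilinear => a b; apply: rip3.
  (* N has rank at most r because it is the normal part of X, and T has rank at most 2r, so their
     combinations stay within rank 3r. *)
  rewrite (_ : 3 * r = r + 2 * r)%N; last by rewrite mulSn.
  rewrite (leq_trans (mxrank_add _ _))// leq_add// (leq_trans (mxrank_scale _ _))//.
    by rewrite hN (leq_trans (normal_rank _ _ _)).
  exact: tangent_rank hT.
have N0 : inner N T = 0 by rewrite /N tproj_orth.
have EN : X - Y = E + N by rewrite /N [RHS]addrC subrK.
apply: frob_le_of_dual.
  by rewrite mulr_ge0 ?frob_ge0// addr_ge0// mulr_ge0// addr_ge0.
have -> : inner T T = inner E T - alpha * inner PG T.
  by rewrite -innerZl -innerNl -innerDl.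
rewrite inner_projected_gradient// EN linearD (innerDl (A E)).
have -> : inner E T - alpha * (inner (A E) (A T) + inner (A N) (A T))
  = (1 - alpha) * inner E T
  - alpha * (inner (A E) (A T) - inner E T) - alpha * (inner (A N) (A T) - inner N T).
  by rewrite N0; ring.
apply: le_trans (ler_norm _) _; apply: le_trans (ler_normB _ _) _.
apply: le_trans (lerD (ler_normB _ _) (lexx _)) _.
rewrite !normrM (distrC 1) !mulrDl mulrDr mulrDl mulrDl addrA.
have f0 := frob_ge0 T.
apply: lerD; first apply: lerD.
- rewrite -mulrA ler_wpM2l//; apply: le_trans (cauchy_schwarz _ _) _.
  by rewrite ler_wpM2r.
- rewrite -!mulrA ler_wpM2l//; apply: le_trans bE _.
  by rewrite ler_wpM2l// ler_wpM2r.
- rewrite -!mulrA ler_wpM2l//; apply: le_trans bN _.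
  by rewrite ler_wpM2l// ler_wpM2r.
Qed.

End OneStep.

(** * Error recursion and its decay rate *)

Section Iteration.
Set Implicit Arguments.
Unset Strict Implicit.
Context {R : realType}.

Lemma rcg_step_error r m n p (A : {linear 'M[R]_(m, n) -> 'cV[R]_p})
    (c2 c3 kappa1 s : R) (U : 'M[R]_(m, r)) (V : 'M[R]_(n, r)) d
    (X Y Y' q : 'M[R]_(m, n)) (beta : R)
    (PG := tproj U V (adjoint A (A X - A Y))) (P := PG + beta *: q) :
  0 <= c2 < 1 -> 0 <= c3 -> 0 <= kappa1 ->
  0 < (1 - c2) - kappa1 * (1 + c2) ->
  rip A (2 * r) c2 -> rip A (3 * r) c3 ->
  is_svd U d V Y -> (\rank X <= r)%N -> is_sigma_min X s ->
  tangent_space U V q ->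
  (beta = 0 \/ `|inner PG q| <= kappa1 * (frob PG * frob q) /\
               beta = - (inner (A PG) (A q) / frob (A q) ^+ 2)) ->
  hard_threshold r (Y + (inner PG P / frob (A P) ^+ 2) *: P) Y' ->
  frob (Y' - X) <=
    2 * ((c2 + c3) * (1 + eps_alpha kappa1 c2) + eps_alpha kappa1 c2) * frob (Y - X)
    + 2 * (frob (Y - X) ^+ 2 / s)
    + 2 * (1 + eps_alpha kappa1 c2) * (`|beta| * frob q).
Proof.
move=> c01 c3_ge0 k1 den rip2 rip3 svd rX hs hq hbeta hY'.
have [c0 c1] := andP c01.
have hnear a b : near_isometric A c2 (a *: PG + b *: q).
  by apply: (tangent_near (U := U) (V := V) rip2) => //; exact: tproj_tangent.
have [alpha alpha1 alphaE] := step_length c01 k1 den hnear hbeta.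
move: hY'; rewrite -/P in alphaE *; rewrite {}alphaE => hY'.
set ea := eps_alpha kappa1 c2 in alpha1 *.
have alpha_le : `|alpha| <= 1 + ea.
  rewrite -[alpha](subrK 1); apply: le_trans (ler_normD _ _) _.
  by rewrite normr1 addrC lerD2l.
set W := Y + alpha *: P in hY'.
(* Y' is at least as close to W as X, whose rank is at most r; the triangle inequality through W
   yields the factor 2. *)
have WX : frob (Y' - X) <= 2 * frob (W - X).
  rewrite -(subrK W Y') -addrA; apply: le_trans (frob_triangle _ _) _.
  by rewrite mulr_natl mulr2n lerD2r (frobB W) (eckart_young hY').
apply: le_trans WX _.
have -> : W - X =
    - ((X - tproj U V X) + (tproj U V (X - Y) - alpha *: PG)) + (alpha * beta) *: q.
  rewrite -(normal_svd X svd) /W /P scalerDr scalerA (addrA (X - Y - _)) subrK opprB.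
  by rewrite opprB addrAC addrA; congr (_ + _); exact: addrC.
have tri := frob_triangle
  (- ((X - tproj U V X) + (tproj U V (X - Y) - alpha *: PG))) ((alpha * beta) *: q).
apply: le_trans (ler_wpM2l _ tri) _ => //; rewrite frobN frobZ normrM.
have tri2 := frob_triangle (X - tproj U V X) (tproj U V (X - Y) - alpha *: PG).
have h1 := frob_normal_quadratic hs svd.
have h2 := tangential_error c0 c3_ge0 rip2 rip3 svd rX alpha.
have h3 : `|alpha| * `|beta| * frob q <= (1 + ea) * (`|beta| * frob q).
  by rewrite -mulrA ler_wpM2r// mulr_ge0 ?frob_ge0.
have h4 : (`|alpha - 1| + `|alpha| * (c2 + c3)) * frob (Y - X)
    <= (ea + (1 + ea) * (c2 + c3)) * frob (Y - X).
  by rewrite ler_wpM2r ?frob_ge0// lerD// ler_wpM2r// addr_ge0.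
rewrite -/PG in h2; lra.
Qed.

(** x is the larger root of x^2 = t1 x + t2. It is below 1 when the square root is below 2 - t1,
    which after squaring reads t1 + t2 < 1. *)
Lemma root_properties (t1 t2 : R) (x := (t1 + Num.sqrt (t1 ^+ 2 + 4 * t2)) / 2) :
  0 <= t1 -> 0 <= t2 ->
  [/\ x ^+ 2 = t1 * x + t2, t1 <= x & t1 + t2 < 1 -> x < 1].
Proof.
move=> t10 t20; have D0 : 0 <= t1 ^+ 2 + 4 * t2 by rewrite addr_ge0 ?sqr_ge0// mulr_ge0.
have := sqr_sqrtr D0; have := sqrtr_ge0 (t1 ^+ 2 + 4 * t2).
rewrite {}/x; move: (Num.sqrt _) => w w0 w2.
have t1w : t1 <= w.
  by rewrite -(ler_pXn2r (n := 2)) ?nnegrE// w2 lerDl mulr_ge0.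
split; [by field: w2 | lra | move=> t12].
suff : w < 2 - t1 by lra.
rewrite -(ltr_pXn2r (n := 2)) ?nnegrE//; last lra.
by rewrite w2; lra.
Qed.

(* pp l is the size of the direction preceding iterate l. *)
Lemma two_term_decay (t e K M x : R) (c pp : nat -> R) :
  0 <= t -> 0 <= e -> 0 <= K -> 0 <= M -> (forall l, 0 <= c l) ->
  x ^+ 2 = (t + e) * x + K * M -> t <= x -> x <= 1 ->
  pp 0%N = 0 ->
  (forall l, c l <= c 0%N -> c l.+1 <= t * c l + K * pp l) ->
  (forall l, pp l.+1 <= M * c l + e * pp l) ->
  forall l, c l <= x ^+ l * c 0%N.
Proof.
move=> t0 e0 K0 M0 cge0 x2 tx x1 p0 hc hp l.
have x0 : 0 <= x by exact: le_trans tx.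
(* The companion bound on [pp] has weight x - t, exactly what lets t + (x - t) = x advance the bound
   on [c]. *)
suff [] : c l <= x ^+ l * c 0%N /\ K * pp l <= (x - t) * x ^+ l * c 0%N by [].
elim: l => [|l [IHc IHp]].
  by rewrite expr0 mul1r p0 mulr0 !mulr_ge0// subr_ge0.
have cl : c l <= c 0%N.
  by apply: le_trans IHc _; rewrite -[leRHS]mul1r ler_wpM2r// exprn_ile1.
have h1 := hc _ cl; have h2 := ler_wpM2l K0 (hp l).
have h3 := ler_wpM2l t0 IHc; have h4 := ler_wpM2l e0 IHp.
have h5 := ler_wpM2l (mulr_ge0 K0 M0) IHc.
split; rewrite exprS; first by apply: le_trans h1 _; lra.
apply: le_trans h2 _.
have -> : (x - t) * (x * x ^+ l) * c 0%N = (x ^+ 2 - t * x) * x ^+ l * c 0%N by ring.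
(* The characteristic equation leaves the slack e t x^l c_0, which is nonnegative. *)
rewrite x2; have h6 : 0 <= e * t * x ^+ l * c 0%N by rewrite !mulr_ge0// exprn_ge0.
lra.
Qed.

End Iteration.

(** * Limit of gamma and sufficient conditions for gamma < 1 *)

Section Rate.
Set Implicit Arguments.
Unset Strict Implicit.
Context {R : realType}.

(** The squared norm is the sum of the squared singular values; only the first rank X of them can be
    nonzero, and each is at most s. *)
Lemma frob_le_sigma_max m n (X : 'M[R]_(m, n)) s :
  is_sigma_max X s -> frob X <= Num.sqrt (\rank X)%:R * s.
Proof.
move=> [[U [d [V [svd [i0 s_def]]]]] ub].
have tail := svd_tail0 erefl svd.
have hds i : d 0 i <= s by apply: ub; exists U, d, V; split => //; exists i.
case: svd => hU hV d0 dd XE; have s0 : 0 <= s by rewrite s_def.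
rewrite -(ler_pXn2r (n := 2)) ?nnegrE ?mulr_ge0 ?frob_ge0 ?sqrtr_ge0//.
rewrite exprMn (sqr_sqrtr (ler0n _ _)).
have -> : frob X ^+ 2 = \sum_i d 0 i ^+ 2 by rewrite XE frob_svd_diag.
rewrite (bigID (fun i : 'I__ => (i < \rank X)%N)) /= [X in _ + X]big1 ?addr0; last first.
  by move=> i; rewrite -leqNgt => /tail ->; rewrite expr0n.
have rk : (\rank X <= minn m n)%N by rewrite leq_min rank_leq_row rank_leq_col.
rewrite (big_ord_narrow rk) mulr_natl -[X in _ *+ X]card_ord -sumr_const.
by apply: ler_sum => i _; rewrite ler_pXn2r ?nnegrE.
Qed.

(** [eps_alpha] tends to 0, its denominator tending to 1 - kappa1 > 0, and [eps_beta] to kappa1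
    kappa2; so [tau1] contributes kappa1 kappa2 and [tau2] twice that. *)
Lemma gamma_cvg (kappa1 kappa2 smin nX : R) : kappa1 < 1 ->
  gamma kappa1 kappa2 smin nX z.1 z.2 @[z --> ((0, 0) : R * R)] --> 3 * kappa1 * kappa2.
Proof.
move=> k1.
have h1 : z.1 @[z --> ((0, 0) : R * R)] --> (0 : R) by exact: cvg_fst.
have h2 : z.2 @[z --> ((0, 0) : R * R)] --> (0 : R) by exact: cvg_snd.
pose F := nbhs ((0, 0) : R * R).
have cst (a : R) : (fun _ : R * R => a) @ F --> a by exact: cvg_cst.
have m1 : (1 - z.1) @[z --> F] --> (1 - 0 : R) by apply: cvgB.
have p1 : (1 + z.1) @[z --> F] --> (1 + 0 : R) by apply: cvgD.
have ea : eps_alpha kappa1 z.1 @[z --> F] --> 0 / (1 - 0 - kappa1 * (1 + 0)).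
  apply: cvgM => //; apply: cvgV; first by rewrite subr0 addr0 mulr1 subr_eq0 gt_eqF.
  by apply: cvgB => //; apply: cvgM.
have eb : eps_beta kappa1 kappa2 z.1 @[z --> F]
    --> kappa2 * 0 / (1 - 0) + kappa1 * kappa2 / (1 - 0).
  have i1 : (1 - z.1)^-1 @[z --> F] --> (1 - 0 : R)^-1.
    by apply: cvgV => //; rewrite subr0 oner_eq0.
  by apply: cvgD; apply: cvgM => //; apply: cvgM.
move: ea eb; rewrite !(subr0, addr0, mulr0, mul0r, add0r, divr1, mulr1) => ea eb.
have -> : 3 * kappa1 * kappa2 =
    (2 * (0 + 0) * (1 + 0) + 2 * 0 + 4 * 0 / smin * nX + kappa1 * kappa2)
    + 2 * (kappa1 * kappa2) * (1 + 0) * (1 + 0) by ring.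
apply: cvgD; last first.
  by apply: cvgM => //; apply: cvgM; [apply: cvgM | apply: cvgD].
apply: cvgD => //; apply: cvgD; last first.
  by apply: cvgM => //; apply: cvgM => //; apply: cvgM.
apply: cvgD; last by apply: cvgM.
by apply: cvgM; [apply: cvgM => //; apply: cvgD | apply: cvgD].
Qed.

Lemma gamma_lt1_small (kappa1 kappa2 smin nX : R) :
  0 < kappa1 < 1 -> kappa1 * kappa2 < 1 / 3 ->
  exists2 delta : R, 0 < delta &
    forall a b : R, 0 <= a < delta -> 0 <= b < delta ->
      0 < (1 - a) - kappa1 * (1 + a) /\ gamma kappa1 kappa2 smin nX a b < 1.
Proof.
move=> /andP[k0 k1] k12.
have : \forall z \near ((0, 0) : R * R), gamma kappa1 kappa2 smin nX z.1 z.2 < 1.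
  have h : 3 * kappa1 * kappa2 < 1 by lra.
  have hg := @gamma_cvg kappa1 kappa2 smin nX k1.
  exact: (cvgr_lt _ hg _ h).
move=> /nbhs_ballP[e /= e0 he].
(* The second bound keeps the denominator of [eps_alpha] positive, since a (1 + kappa1) <= 2 a < 1 -
   kappa1. *)
exists (Num.min e ((1 - kappa1) / 2)); first by rewrite lt_min e0; lra.
move=> a b; rewrite !lt_min => /and3P[a0 ae a1] /and3P[b0 be b1]; split; first nra.
apply: (he (a, b)); split => /=; rewrite /ball /= sub0r normrN ger0_norm//.
Qed.

(* 22/21, 73/500 and 4/25 bound 1 + eps_alpha, eps_beta and the last quotient
   in tau1 when both constants are at most 1/25. *)
Lemma gamma_lt1_tenth (smin nX a b : R) :
  0 <= a -> a <= b -> b <= 1 / 25 -> 0 < smin -> a * nX <= smin / 25 ->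
  0 < (1 - a) - (1 / 10) * (1 + a) /\ gamma (1 / 10) 1 smin nX a b < 1.
Proof.
move=> a0 ab b1 s0 hX; have d0 : 0 < (1 - a) - (1 / 10) * (1 + a) by lra.
split=> //; rewrite /gamma /tau2 /tau1.
have ea : 0 <= eps_alpha (1 / 10) a <= 1 / 21.
  by rewrite /eps_alpha divr_ge0 ?(ltW d0)//= ler_pdivrMr//; lra.
have eb : 0 <= eps_beta (1 / 10) 1 a <= 73 / 500.
  have d1 : 0 < 1 - a by lra.
  rewrite /eps_beta -mulrDl divr_ge0 ?(ltW d1)//=; last lra.
  by rewrite ler_pdivrMr//; lra.
have hq : 4 * a / smin * nX <= 4 / 25.
  by rewrite mulrAC ler_pdivrMr//; lra.
move: ea eb hq; move: (eps_alpha _ _) (eps_beta _ _ _) (4 * a / smin * nX) => u v w.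
move=> /andP[u0 u1] /andP[v0 v1] w1.
have g1 : (a + b) * (1 + u) <= 2 / 25 * (22 / 21) by apply: ler_pM; lra.
have g2 : v * (1 + u) <= 73 / 500 * (22 / 21) by apply: ler_pM; lra.
have g3 : v * (1 + u) * (1 + a) <= 73 / 500 * (22 / 21) * (26 / 25).
  by apply: ler_pM => //; [rewrite mulr_ge0//; lra | lra | lra].
(* The bounds on the terms of gamma add up to less than 0.89. *)
lra.
Qed.

End Rate.

(** * Convergence of the restarted conjugate gradient iterates *)

Section Convergence.
Set Implicit Arguments.
Unset Strict Implicit.
Context {R : realType} {r m n p : nat}.
Variable A : {linear 'M[R]_(m, n) -> 'cV[R]_p}.
Variables (X : 'M[R]_(m, n)) (smin c2 c3 kappa1 kappa2 : R).
Hypotheses (rX : (\rank X <= r)%N) (hs : is_sigma_min X smin).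
Hypotheses (c2_ge0 : 0 <= c2) (c3_ge0 : 0 <= c3).
Hypotheses (rip2 : rip A (2 * r) c2) (rip3 : rip A (3 * r) c3).
Hypotheses (k1 : 0 < kappa1) (k2 : 0 <= kappa2).
Hypothesis den : 0 < (1 - c2) - kappa1 * (1 + c2).

Let ea := eps_alpha kappa1 c2.
Let eb := eps_beta kappa1 kappa2 c2.
Let t1 := tau1 kappa1 kappa2 smin (frob X) c2 c3.
Let t2 := tau2 kappa1 kappa2 c2.
Let x := mu kappa1 kappa2 smin (frob X) c2 c3.

Let c01 : 0 <= c2 < 1.
Proof.
rewrite c2_ge0 /=; have : 0 <= kappa1 * (1 + c2) by rewrite mulr_ge0 ?ltW// ltr_wpDr.
by move: den; lra.
Qed.

Let ea0 : 0 <= ea. Proof. exact: eps_alpha_ge0. Qed.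
Let eb0 : 0 <= eb. Proof. exact: eps_beta_ge0 (ltW k1) k2. Qed.

Let hq0 : 0 <= 4 * c2 / smin * frob X.
Proof. by rewrite mulr_ge0 ?frob_ge0// divr_ge0 ?mulr_ge0// ltW// (sigma_min_gt0 hs). Qed.

(** In the recursion [tau1] splits into [t1 - eb], the weight of the current error, and [eb], the
    weight with which directions carry over. *)
Let t1_eb : 0 <= t1 - eb.
Proof.
have h : 0 <= (c2 + c3) * (1 + ea) by rewrite mulr_ge0 ?addr_ge0.
by rewrite /t1 /tau1 -/ea -/eb addrK !addr_ge0// -?mulrA mulr_ge0.
Qed.

Let t2_ge0 : 0 <= t2.
Proof. by rewrite /t2 /tau2 !mulr_ge0// addr_ge0. Qed.

Let t1_ge0 : 0 <= t1. Proof. by rewrite -(subrK eb t1) addr_ge0. Qed.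

Lemma mu_lt1 : gamma kappa1 kappa2 smin (frob X) c2 c3 < 1 -> x < 1.
Proof.
by have [_ _] := root_properties t1_ge0 t2_ge0.
Qed.

Variables (X_ : nat -> 'M[R]_(m, n)) (U_ : nat -> 'M[R]_(m, r)).
Variable V_ : nat -> 'M[R]_(n, r).
Variables (G_ P_ W_ : nat -> 'M[R]_(m, n)) (alpha_ beta_ : nat -> R).
Hypothesis rcg : restarted_RCG A (A X) kappa1 kappa2 X_ U_ V_ G_ P_ W_ alpha_ beta_.

Let PG l := tproj (U_ l) (V_ l) (adjoint A (A X - A (X_ l))).
(** Encodes the convention that the direction before the first iterate is zero, with the index
    shifted by one. *)
Let previous l := if l is l'.+1 then frob (P_ l') else 0.

(** Puts the first iterate (with q = 0), restarts and conjugate steps into the single form that the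
    one-step estimates expect. *)
Lemma rcg_direction l :
  exists q, [/\ tangent_space (U_ l) (V_ l) q, P_ l = PG l + beta_ l *: q,
    frob q <= previous l, `|beta_ l| <= eb &
    beta_ l = 0 \/ `|inner (PG l) q| <= kappa1 * (frob (PG l) * frob q) /\
                   beta_ l = - (inner (A (PG l)) (A q) / frob (A q) ^+ 2)].
Proof.
case: l => [|l].
  exists 0; rewrite (rcg_beta0 rcg) normr0 frob0; split => //; last by left.
    by exists 0, 0; rewrite trmx0 mulmx0 mul0mx addr0.
  by rewrite scale0r addr0 (rcg_dir0 rcg) (rcg_grad rcg).
have [d svd] := rcg_svd rcg l.+1; have [hU hV _ _ _] := svd.
set q := tproj (U_ l.+1) (V_ l.+1) (P_ l).
have hq : tangent_space (U_ l.+1) (V_ l.+1) q by exact: tproj_tangent.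
exists q; split => //.
- by rewrite (rcg_dirS rcg) (rcg_grad rcg).
- exact: frob_tproj.
all: rewrite (rcg_betaS rcg) (rcg_grad rcg) -/(PG l.+1) -/q; case: ifP => [|_];
  rewrite ?normr0//; try by left.
all: move=> /andP[ang len].
(* The angle test is a quotient that is 0 when a norm vanishes; in that case the product form
   follows from Cauchy-Schwarz. *)
all: have {}ang : `|inner (PG l.+1) q| <= kappa1 * (frob (PG l.+1) * frob q).
1,3: have [z|z] := eqVneq (frob (PG l.+1) * frob q) 0;
  [by rewrite z mulr0 -z cauchy_schwarz
  |by rewrite -ler_pdivrMr// lt0r z mulr_ge0 ?frob_ge0].
  rewrite normrN; apply: (@beta_bound _ _ _ _ A) => //; first exact: ltW.
  move=> a b; apply: (tangent_near (U := U_ l.+1) (V := V_ l.+1) rip2) => //.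
  exact: tproj_tangent.
by right.
Qed.

Lemma rcg_iterate_bound l : hard_threshold r (adjoint A (A X)) (X_ 0%N) ->
  frob (X_ l - X) <= frob (X_ 0%N - X) ->
  frob (X_ l.+1 - X) <=
    (t1 - eb) * frob (X_ l - X) + 2 * eb * (1 + ea) * previous l.
Proof.
move=> hX0 hl; have [d svd] := rcg_svd rcg l; have [hU hV _ _ _] := svd.
have [q [hq PE q_le b_le hb]] := rcg_direction l.
(* The direction is already tangent, so the projection in the step length leaves it unchanged. *)
have tP : tproj (U_ l) (V_ l) (P_ l) = P_ l.
  apply: tproj_id => //; rewrite PE -[PG l]scale1r.
  by apply: tangent_lin => //; exact: tproj_tangent.
have hW := rcg_next rcg l.
rewrite (rcg_line rcg) (rcg_step rcg) tP (rcg_grad rcg) -/(PG l) PE in hW.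
have := rcg_step_error c01 c3_ge0 (ltW k1) den rip2 rip3 svd rX hs hq hb hW.
move=> /le_trans; apply; rewrite -/ea.
have [d0 svd0] := rcg_svd rcg 0%N.
have h0 := initial_error rip2 c2_ge0 rX (svd_rank svd0) hX0.
have s0 := sigma_min_gt0 hs; set e := frob (X_ l - X) in hl *.
have e0 : 0 <= e by exact: frob_ge0.
(* One factor e is bounded by the initial error, at most 2 c2 |X|, which makes the quadratic term
   linear. *)
have sq : 2 * (e ^+ 2 / smin) <= 4 * c2 / smin * frob X * e.
  rewrite (_ : 4 * _ / _ * _ * _ = 2 * (2 * c2 * frob X * e / smin)); last by ring.
  rewrite ler_wpM2l// ler_wpM2r ?invr_ge0 ?(ltW s0)// expr2 ler_wpM2r//.
  exact: le_trans hl h0.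
have bq : 2 * (1 + ea) * (`|beta_ l| * frob q) <= 2 * (1 + ea) * (eb * previous l).
  by rewrite ler_wpM2l ?mulr_ge0 ?addr_ge0// ler_pM ?frob_ge0.
rewrite /t1 /tau1 -/ea -/eb addrK; lra.
Qed.

Lemma rcg_direction_bound l :
  frob (P_ l) <= (1 + c2) * frob (X_ l - X) + eb * previous l.
Proof.
have [d svd] := rcg_svd rcg l; have [q [hq -> q_le b_le _]] := rcg_direction l.
apply: le_trans (frob_triangle _ _) _; rewrite frobZ lerD//.
  exact: (projected_gradient_bound c2_ge0 rip2 svd rX).
by rewrite ler_pM ?frob_ge0.
Qed.

Lemma rcg_convergence l : gamma kappa1 kappa2 smin (frob X) c2 c3 < 1 ->
  hard_threshold r (adjoint A (A X)) (X_ 0%N) ->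
  frob (X_ l - X) <= x ^+ l * frob (X_ 0%N - X).
Proof.
move=> hg hX0; have [x2 tx _] := root_properties t1_ge0 t2_ge0; rewrite -/x in x2 tx.
(* With these choices t + e is [tau1] and K M is [tau2], so the characteristic root is [mu]. *)
apply: (@two_term_decay _ (t1 - eb) eb (2 * eb * (1 + ea)) (1 + c2) x
  (fun l => frob (X_ l - X)) previous) => //.
- by rewrite !mulr_ge0// addr_ge0.
- by rewrite addr_ge0.
- by move=> k; exact: frob_ge0.
- by rewrite subrK.
- by apply: le_trans tx; rewrite gerBl.
- by rewrite ltW// mu_lt1.
- by move=> k; exact: rcg_iterate_bound.
- by move=> k; exact: rcg_direction_bound.
Qed.

End Convergence.

Theorem theorem2p2 (R : realType) (m n p r : nat)
    (A : {linear 'M[R]_(m, n) -> 'cV[R]_p})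
    (X : 'M[R]_(m, n)) (y : 'cV[R]_p)
    (smin smax R2r R3r kappa1 kappa2 : R)
    (hp : (p < m * n)%N)
    (hy : y = A X)
    (hrank : \rank X = r)
    (hr0 : (0 < r)%N)
    (hr : (r < minn m n)%N)
    (hsmin : is_sigma_min X smin)
    (hsmax : is_sigma_max X smax)
    (hR2r : is_RIC A (2 * r) R2r)
    (hR3r : is_RIC A (3 * r) R3r)
    (hk1 : 0 < kappa1 < 1)
    (hk2 : 1 <= kappa2) :
  [/\
    (* (1) *)
    (0 < (1 - R2r) - kappa1 * (1 + R2r) ->
     gamma kappa1 kappa2 smin (frob X) R2r R3r < 1 ->
     mu kappa1 kappa2 smin (frob X) R2r R3r < 1 /\
     forall (X_ : nat -> 'M[R]_(m, n))
            (U_ : nat -> 'M[R]_(m, r)) (V_ : nat -> 'M[R]_(n, r))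
            (G_ P_ W_ : nat -> 'M[R]_(m, n)) (alpha_ beta_ : nat -> R),
       restarted_RCG A y kappa1 kappa2 X_ U_ V_ G_ P_ W_ alpha_ beta_ ->
       hard_threshold r (adjoint A y) (X_ 0%N) ->
       forall l : nat,
         frob (X_ l - X) <=
           mu kappa1 kappa2 smin (frob X) R2r R3r ^+ l * frob (X_ 0%N - X)),
    (* (2) *)
    (R2r != 1 ->
     gamma 0 0 smin (frob X) R2r R3r =
       (4 * R2r + 2 * R3r) / (1 - R2r) + 4 * R2r / smin * frob X),
    (* (3) *)
    (gamma kappa1 kappa2 smin (frob X) z.1 z.2
       @[z --> ((0, 0) : R * R)] --> 3 * kappa1 * kappa2) /\
    (kappa1 * kappa2 < 1 / 3 ->
     exists2 delta : R, 0 < delta &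
       forall a b : R, 0 <= a < delta -> 0 <= b < delta ->
         0 < (1 - a) - kappa1 * (1 + a) /\
         gamma kappa1 kappa2 smin (frob X) a b < 1)
  & (* (4) *)
    (R3r <= smin / smax * (1 / (25 * Num.sqrt r%:R)) ->
     0 < (1 - R2r) - (1 / 10) * (1 + R2r) /\
     gamma (1 / 10) 1 smin (frob X) R2r R3r < 1)].
Proof.
have X0 : X != 0 by rewrite -mxrank_eq0 hrank -lt0n.
have rX : (\rank X <= r)%N by rewrite hrank.
have R2_ge0 : 0 <= R2r.
  by apply: (is_RIC_ge0 hR2r _ X0); rewrite hrank leq_pmull.
have R23 : R2r <= R3r by apply: is_RIC_mono hR2r hR3r; rewrite leq_mul2r orbT.
have rip2 := is_RIC_rip hR2r; have rip3 := is_RIC_rip hR3r.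
have s0 := sigma_min_gt0 hsmin; have [k1 k1'] := andP hk1.
have k2 : 0 <= kappa2 by exact: le_trans hk2.
have R3_ge0 := le_trans R2_ge0 R23.
split.
- move=> den hg; split; first exact: (mu_lt1 hsmin).
  move=> X_ U_ V_ G_ P_ W_ alpha_ beta_ rcg hX0 l; rewrite {}hy in rcg hX0.
  exact: (rcg_convergence rX hsmin _ _ rip2 rip3 _ _ _ rcg).
(* For zero constants [eps_beta] vanishes and 1 + [eps_alpha] = 1 / (1 - R2r). *)
- move=> R1; rewrite /gamma /tau2 /tau1 /eps_beta /eps_alpha.
  by field; rewrite subr_eq0 (eq_sym 1) R1 gt_eqF.
- by split; [exact: gamma_cvg | exact: gamma_lt1_small].
- move=> hR.
  have smm : smin <= smax by case: hsmax => _; apply; case: hsmin => -[].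
  have sm0 : 0 < smax by exact: lt_le_trans smm.
  have rr : 1 <= Num.sqrt r%:R :> R by rewrite -[leLHS]sqrtr1 ler_sqrt ?ler1n ?ltr0n.
  have hX := frob_le_sigma_max hsmax; rewrite hrank in hX.
  (* This product form gives R3r <= 1/25, from smin <= smax and sqrt r >= 1, and R2r |X| <= smin /
     25, from |X| <= sqrt r smax. *)
  have hR' : R3r * (smax * Num.sqrt r%:R) <= smin / 25.
    move: hR; rewrite (_ : _ * (1 / _) = smin / 25 / (smax * Num.sqrt r%:R)).
      by rewrite ler_pdivlMr// mulr_gt0// (lt_le_trans _ rr).
    by field; rewrite !gt_eqF// (lt_le_trans _ rr).
  apply: gamma_lt1_tenth => //.
    rewrite -(ler_pM2r sm0); apply: (@le_trans _ _ (R3r * (smax * Num.sqrt r%:R))).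
      by rewrite ler_wpM2l// ler_peMr// ltW.
    by apply: le_trans hR' _; lra.
  apply: le_trans hR'; rewrite [smax * _]mulrC; apply: ler_pM => //; exact: frob_ge0.
Qed.
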